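(* Let $G_B$ be a graph on $m$ vertices whose adjacency matrix $B$ is invertible. For an integer $l\ge1$ denote by $G_B^{1,l}$ the graph constructed from $G_B$ by adding a pendant path $\mathbb{P}_l$ to each vertex of $G_B$. Then the adjacency matrix $\mathscr{M}$ of $G_B^{1,l}$ is invertible. Moreover: (1) If $l$ is odd, then $G_B^{1,l}$ is a negatively integrally invertible graph. If, in addition, there exists an $m\times m$ signature matrix $D_-$ such that $D_-BD_-\le0$ (entrywise), then $G_B^{1,l}$ is a positively integrally invertible graph. (2) If $l$ is even, then $G_B^{1,l}$ is a positively (respectively negatively) invertible graph provided that $G_B$ is a positively (respectively negatively) invertible graph.
   Context: Graphs are finite, undirected and simple, with symmetric binary adjacency matrix; $G_B$ denotes the graph with adjacency matrix $B$. $\mathbb{P}_l$ is the path graph on $l$ vertices. Adding a pendant path $\mathbb{P}_l$ to each vertex means: for each vertex $v$ of $G_B$ one takes a new disjoint copy of $\mathbb{P}_l$ and joins one of its end vertices to $v$ by an edge (so $G_B^{1,l}$ has $(l+1)m$ vertices). A signature matrix is a diagonal matrix with diagonal entries in $\{+1,-1\}$. A graph $G_A$ with adjacency matrix $A$ is positively (resp. negatively) invertible if $A$ is invertible and there is a signature matrix $D$ such that all entries of $DA^{-1}D$ are nonnegative (resp. nonpositive). It is positively (resp. negatively) integrally invertible if $\det(A)=\pm1$ and there is a signature matrix $D$ such that $DA^{-1}D$ is an integral matrix with nonnegative (resp. nonpositive) entries. *)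

(* Defs.v *)
From HB Require Import structures.
From mathcomp Require Import all_boot all_order all_algebra.

Set Implicit Arguments.
Unset Strict Implicit.
Unset Printing Implicit Defensive.

Import GRing.Theory Num.Theory.

Local Open Scope ring_scope.

Record sgraph := SGraph {
  svertex :> finType;
  sedge : rel svertex;
  sedge_sym : symmetric sedge;
  sedge_irrefl : irreflexive sedge }.

(* The vertices are numbered by the canonical enumeration of the vertex type;
   another numbering conjugates the matrix by a permutation matrix, which
   affects none of the properties below. *)
Definition adjmx (R : pzSemiRingType) (G : sgraph) : 'M[R]_#|G| :=
  \matrix_(i, j) (sedge (enum_val i) (enum_val j))%:R.

Definition path_rel (l : nat) : rel 'I_l :=
  fun i j => (i.+1 == j :> nat) || (j.+1 == i :> nat).

Lemma path_rel_sym l : symmetric (@path_rel l).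
Proof. by move=> i j; rewrite /path_rel orbC. Qed.

Lemma path_rel_irrefl l : irreflexive (@path_rel l).
Proof. by move=> i; rewrite /path_rel orbb eqn_leq ltnn. Qed.

Definition path_graph (l : nat) : sgraph :=
  SGraph (@path_rel_sym l) (@path_rel_irrefl l).

(* [inr (v, i)] is the vertex [i] of the copy of the path attached to [v];
   the end vertex 0 of that copy is the one joined to [v]. *)
Definition pendant_rel (G : sgraph) (l : nat) : rel (G + G * path_graph l) :=
  fun x y =>
    match x, y with
    | inl v, inl w => sedge v w
    | inl v, inr (w, i) => (v == w) && (i == 0 :> nat)
    | inr (v, i), inl w => (v == w) && (i == 0 :> nat)
    | inr (v, i), inr (w, j) => (v == w) && sedge i j
    end.

Lemma pendant_rel_sym G l : symmetric (@pendant_rel G l).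
Proof.
case=> [v|[v i]] [w|[w j]] //=; last by rewrite eq_sym path_rel_sym.
- exact: sedge_sym.
- by rewrite eq_sym.
- by rewrite eq_sym.
Qed.

Lemma pendant_rel_irrefl G l : irreflexive (@pendant_rel G l).
Proof.
by case=> [v|[v i]] /=; rewrite ?sedge_irrefl // path_rel_irrefl andbF.
Qed.

Definition pendant_path (G : sgraph) (l : nat) : sgraph :=
  SGraph (@pendant_rel_sym G l) (@pendant_rel_irrefl G l).

Definition signature_mx (R : pzRingType) (n : nat) (D : 'M[R]_n) : Prop :=
  is_diag_mx D /\ (forall i, D i i = 1 \/ D i i = -1).

Definition positively_invertible (R : realFieldType) (G : sgraph) : Prop :=
  let A := adjmx R G in
  A \in unitmx /\
  exists2 D : 'M[R]_#|G|,
    signature_mx D & D *m invmx A *m D \is a mxOver Num.nneg.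

Definition negatively_invertible (R : realFieldType) (G : sgraph) : Prop :=
  let A := adjmx R G in
  A \in unitmx /\
  exists2 D : 'M[R]_#|G|,
    signature_mx D & D *m invmx A *m D \is a mxOver Num.npos.

(* [invmx A] is the inverse only for [A \in unitmx], which \det A = +-1
   guarantees. *)
Definition positively_integrally_invertible
    (R : archiRealFieldType) (G : sgraph) : Prop :=
  let A := adjmx R G in
  (\det A = 1 \/ \det A = -1) /\
  exists D : 'M[R]_#|G|,
    [/\ signature_mx D,
        D *m invmx A *m D \is a mxOver Num.int &
        D *m invmx A *m D \is a mxOver Num.nneg].

Definition negatively_integrally_invertible
    (R : archiRealFieldType) (G : sgraph) : Prop :=
  let A := adjmx R G in
  (\det A = 1 \/ \det A = -1) /\
  exists D : 'M[R]_#|G|,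
    [/\ signature_mx D,
        D *m invmx A *m D \is a mxOver Num.int &
        D *m invmx A *m D \is a mxOver Num.npos].

(* Main.v *)
(* Number the vertices of the path hanging at v together with v itself by
   0, ..., l, so that the adjacency matrix of the extended graph is
   B (x) E_00 + I (x) P, with P the adjacency matrix of the path on l + 1
   vertices.  Writing c = half_sign and using that c_n c_(n+1) = (-1)^n, one
   reads off the inverse.
   If l is even, it is B^-1 (x) u u^T + I (x) Q, where u spans the kernel of P
   (u_n = c_n for n even, 0 for n odd) and Q is the inverse of the path on
   1, ..., l.
   If l is odd, it is I (x) Q - B (x) q q^T, where Q = P^-1 and q is the
   column 0 of Q (q_n = c_n for n odd, 0 for n even).
   In both cases, for n < m, Q_(n,m) is nonzero only if n, m have opposite
   parities and m has the parity of l, and is then -(-1)^l c_n c_m.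
   Conjugating by c removes all signs but -(-1)^l, and that one is absorbed by
   a further sign on the n with the parity opposite to that of l. *)
Require Import Defs.
From HB Require Import structures.
From mathcomp Require Import all_boot all_order all_algebra.
From mathcomp Require Import zify ring.

Set Implicit Arguments.
Unset Strict Implicit.
Unset Printing Implicit Defensive.

Import Order.TTheory GRing.Theory Num.Theory.

Local Open Scope ring_scope.

(** * Matrices indexed by a finite type, signatures and determinants *)

Definition kernel_mx (T : Type) (I : finType) (K : I -> I -> T) : 'M[T]_#|I| :=
  \matrix_(i, j) K (enum_val i) (enum_val j).

Lemma sum_enum_val (V : nmodType) (I : finType) (F : I -> V) :
  \sum_(i < #|I|) F (enum_val i) = \sum_x F x.
Proof.
by rewrite -big_enum_val.
Qed.

(** A one-sided inverse of a square matrix over a commutative ring is two-sided, so one check on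
    vertices, free of their numbering, yields the inverse. *)
Lemma adjmx_inverse (R : comUnitRingType) (G : sgraph) (K : G -> G -> R) :
    (forall x z, \sum_y (sedge x y)%:R * K y z = (x == z)%:R) ->
  adjmx R G \in unitmx /\ invmx (adjmx R G) = kernel_mx K.
Proof.
move=> HK.
have AK : adjmx R G *m kernel_mx K = 1%:M.
  apply/matrixP=> i j; rewrite !mxE -(inj_eq enum_val_inj) -HK -[RHS]sum_enum_val.
  by apply: eq_bigr => k _; rewrite !mxE.
have [uA _] := mulmx1_unit AK; split=> //.
by rewrite -[RHS](mulKmx uA) AK mulmx1.
Qed.

Lemma adjmx_sum (R : pzSemiRingType) (G : sgraph) (F : 'I_#|G| -> R) (x : G) :
  \sum_j adjmx R G (enum_rank x) j * F j =
  \sum_y (sedge x y)%:R * F (enum_rank y).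
Proof.
rewrite -(sum_enum_val (fun y => (sedge x y)%:R * F (enum_rank y))).
by apply: eq_bigr => j _; rewrite mxE enum_rankK enum_valK.
Qed.

Lemma signature_conjE (R : pzRingType) n (D A : 'M[R]_n) i j :
  signature_mx D -> (D *m A *m D) i j = D i i * A i j * D j j.
Proof.
case=> /is_diag_mxP dD _; rewrite mxE (bigD1 j) //= big1 ?addr0; last first.
  by move=> k kj; rewrite [D k j]dD ?mulr0.
rewrite mxE (bigD1 i) //= big1 ?addr0 // => k; rewrite eq_sym => ki.
by rewrite dD ?mul0r.
Qed.

Lemma signature_mx_diag (R : pzRingType) (I : finType) (s : I -> R) :
    (forall x, s x = 1 \/ s x = -1) ->
  signature_mx (diag_mx (\row_(i < #|I|) s (enum_val i))).
Proof.
move=> Hs; split=> [|i]; first exact: diag_mx_is_diag.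
by rewrite !mxE eqxx; exact: Hs.
Qed.

(** The factor [(-1) ^+ false] gives this the shape of the [npos] case, so that a boolean sign
    treats both at once. *)
Lemma mxOver_nnegP (R : numDomainType) m n (A : 'M[R]_(m, n)) :
  reflect (forall i j, 0 <= (-1) ^+ false * A i j) (A \is a mxOver Num.nneg).
Proof.
by apply: (iffP mxOverP) => H i j; move: (H i j); rewrite expr0 mul1r.
Qed.

Lemma mxOver_nposP (R : numDomainType) m n (A : 'M[R]_(m, n)) :
  reflect (forall i j, 0 <= (-1) ^+ true * A i j) (A \is a mxOver Num.npos).
Proof.
apply: (iffP mxOverP) => H i j; move: (H i j);
by rewrite expr1 mulN1r oppr_ge0 nposrE.
Qed.

(** Both determinants are nonzero integers, hence at least 1 in absolute value, and these absolute
    values multiply to 1. *)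
Lemma det_int_inverse (R : archiRealFieldType) n (A : 'M[R]_n) :
    A \in unitmx -> A \is a mxOver Num.int -> invmx A \is a mxOver Num.int ->
  \det A = 1 \/ \det A = -1.
Proof.
have det_int (B : 'M[R]_n) : B \is a mxOver Num.int -> \det B \is a Num.int.
  move/mxOverP=> HB; apply: rpred_sum => s _.
  by rewrite rpredMsign rpred_prod.
move=> uA /det_int dA /det_int dA'.
have dAA' : `|\det A| * `|\det (invmx A)| = 1.
  by rewrite -normrM -det_mulmx mulmxV ?det1 ?normr1.
have A0 : \det A != 0 by rewrite -unitfE -unitmxE.
have A'0 : \det (invmx A) != 0 by rewrite -unitfE -unitmxE unitmx_inv.
have A_le : `|\det A| <= 1.
  by rewrite -dAA' ler_peMr // norm_intr_ge1.
have /eqP : `|\det A| = 1 by apply/eqP; rewrite eq_le A_le norm_intr_ge1.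
by rewrite eqr_norml ler01 andbT => /orP[] /eqP; [left | right].
Qed.

(** * Vertices of the pendant graph as pairs of base and depth *)

Section PendantPath.
Variables (R : realFieldType) (G : sgraph) (l : nat).

Definition pendant_base (x : pendant_path G l) : G :=
  match x with inl v => v | inr (v, _) => v end.

Definition pendant_depth (x : pendant_path G l) : nat :=
  match x with inl _ => 0 | inr (_, i) => i.+1 end.

Lemma pendant_depth_le x : (pendant_depth x <= l)%N.
Proof. by case: x => [v|[v [i Hi]]]. Qed.

Lemma pendant_eqE x y :
  (x == y) =
  (pendant_base x == pendant_base y) && (pendant_depth x == pendant_depth y).
Proof.
case: x y => [v|[v i]] [w|[w j]] //=.
- by rewrite andbT.
- by rewrite andbF.
- by rewrite andbF.
Qed.

Lemma pendant_sum_inl (f : G -> nat -> R) (v : G) : (0 < l)%N ->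
  \sum_(y : pendant_path G l)
     (sedge (inl v : pendant_path G l) y)%:R
       * f (pendant_base y) (pendant_depth y) =
  \sum_w (sedge v w)%:R * f w 0 + f v 1.
Proof.
move=> l0; rewrite big_sumType /=; congr (_ + _).
rewrite (bigD1 (v, Ordinal l0)) //= !eqxx mul1r big1 ?addr0 // => -[w i] /=.
by rewrite xpair_eqE -val_eqE /= [v == w]eq_sym => /negPf->; rewrite mul0r.
Qed.

(** The vertex [inr (v, i)] has depth [i.+1], so its neighbours have depths [i] and [i.+2]; the
    boolean factor removes the latter at the far end. *)
Lemma pendant_sum_inr (f : G -> nat -> R) (v : G) (i : 'I_l) :
  \sum_(y : pendant_path G l)
     (sedge (inr (v, i) : pendant_path G l) y)%:R
       * f (pendant_base y) (pendant_depth y) =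
  f v i + (i.+1 < l)%:R * f v i.+2.
Proof.
rewrite big_sumType /=.
have -> : \sum_w ((v == w) && (i == 0 :> nat))%:R * f w 0
          = (i == 0 :> nat)%:R * f v 0.
  rewrite (bigD1 v) //= eqxx /= big1 ?addr0 // => w.
  by rewrite eq_sym => /negPf->; rewrite mul0r.
have sum_pair (F : G * 'I_l -> R) : \sum_p F p = \sum_w \sum_j F (w, j).
  by rewrite pair_bigA; apply: eq_bigr => -[].
rewrite sum_pair /= (bigD1 v) //= eqxx /= [X in _ + (_ + X)]big1 ?addr0.
  2: move=> w; rewrite eq_sym => /negPf vw.
  2: by rewrite big1 // => k _; rewrite vw mul0r.
have -> : \sum_(j < l) (path_rel i j)%:R * f v j.+1
  = \sum_(j < l | j.+1 == i :> nat) f v j.+1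
    + \sum_(j < l | i.+1 == j :> nat) f v j.+1.
  rewrite [X in X + _]big_mkcond [X in _ + X]big_mkcond -big_split /=.
  apply: eq_bigr => j _; rewrite /path_rel.
  case: eqP => e1; case: eqP => e2;
    rewrite /= ?mul1r ?mul0r ?addr0 ?add0r //.
  by exfalso; lia.
rewrite addrA; congr (_ + _).
  case: i => -[|i] Hi /=.
    by rewrite mul1r big1 ?addr0.
  rewrite mul0r add0r (big_pred1 (Ordinal (ltnW Hi))) //.
have [Hi|Hi] := ltnP i.+1 l.
  rewrite mul1r (big_pred1 (Ordinal Hi)) //.
rewrite mul0r big1 // => j /eqP e.
by move: (ltn_ord j); rewrite -e ltnNge Hi.
Qed.

(** * Signs of period 4 and the explicit inverse *)

Definition half_sign (n : nat) : R := (-1) ^+ n./2.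

Lemma half_signSS n : half_sign n.+2 = - half_sign n.
Proof. by rewrite /half_sign /= exprS mulN1r. Qed.

Lemma half_sign_sqr n : half_sign n * half_sign n = 1.
Proof. by rewrite -expr2 sqrr_sign. Qed.

Lemma half_signMS n : half_sign n * half_sign n.+1 = (-1) ^+ odd n.
Proof.
rewrite /half_sign /= uphalf_half exprD mulrCA -expr2 sqrr_sign mulr1.
by case: (odd n).
Qed.

(* The matrix tensored with a rank one matrix in the inverse: -B or B^-1. *)
Definition pendant_coef (C : G -> G -> R) (v w : G) : R :=
  if odd l then - (sedge v w)%:R else C v w.

(** One formula for both parities of [l]: first the rank one part, then Q, made symmetric by [minn]
    and [maxn]. *)
Definition pendant_kernel (C : G -> G -> R) (x y : pendant_path G l) : R :=
  let: (v, n) := (pendant_base x, pendant_depth x) in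
  let: (w, m) := (pendant_base y, pendant_depth y) in
  half_sign n * half_sign m *
  (pendant_coef C v w * ((odd n == odd l) && (odd m == odd l))%:R
   - (-1) ^+ odd l *
     [&& v == w, odd (minn n m) != odd l & odd (maxn n m) == odd l]%:R).

Lemma pendant_kernel_inverse (C : G -> G -> R) : (0 < l)%N ->
    (forall v w, \sum_u (sedge v u)%:R * C u w = (v == w)%:R) ->
  forall x z, \sum_y (sedge x y)%:R * pendant_kernel C y z = (x == z)%:R.
Proof.
move=> l0 HC x z; rewrite pendant_eqE /pendant_kernel.
move: (pendant_base z) (pendant_depth z) (pendant_depth_le z) => w m lem.
case: x => [v | [v i]].
  rewrite (pendant_sum_inl (fun u n => half_sign n * half_sign m *
    (pendant_coef C u w * ((odd n == odd l) && (odd m == odd l))%:R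
   - (-1) ^+ odd l *
     [&& u == w, odd (minn n m) != odd l & odd (maxn n m) == odd l]%:R))) //.
  rewrite /pendant_coef /= min0n max0n [half_sign 0]expr0 [half_sign 1]expr0.
  rewrite !mul1r; case: (odd l) => /=.
    (* For [l] odd, the neighbours at depth 0 contribute B through Q; the one at depth 1 contributes
       -B and the diagonal entry. *)
    transitivity (half_sign m * (sedge v w)%:R * (odd m)%:R
      + half_sign m * (- (sedge v w)%:R * (odd m)%:R
         + ((v == w) && (0 == m)%N)%:R)).
      congr (_ + _ * (_ + _)).
      - rewrite (bigD1 w) //= eqxx big1 ?addr0 => [|u /negPf ->] /=.
          by case: (odd m) => /=; ring.
        by ring.
      - by case: (odd m).
      - rewrite expr1 mulN1r opprK; case: m lem => [|m] lem //=.
        by rewrite minnSS min0n /= andbF.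
    case: m lem => [|m] lem /=; last by rewrite andbF /=; ring.
    by rewrite andbT [half_sign 0]expr0; ring.
  (* For [l] even, depth 0 gives the identity at every even [m] by [HC]; depth 1 removes it for
     [m != 0]. *)
  transitivity (half_sign m * (v == w)%:R * (~~ odd m)%:R
    - half_sign m * ((v == w)%:R * (~~ odd m && (m != 0)%N)%:R)).
    congr (_ + _).
      rewrite -HC mulr_sumr mulr_suml; apply: eq_bigr => u _.
      by case: (odd m); rewrite ?andbF /=; ring.
    rewrite expr0 mul1r mulr0 add0r mulrN; congr (- (_ * _)).
    case: m lem => [|[|m]] lem; rewrite /= ?negbK ?andbF ?andbT ?mulr0 //.
    by case: (v == w); case: (odd m) => /=; ring.
  case: m lem => [|m] lem; rewrite ?andbF ?andbT /=; last by ring.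
  by rewrite [half_sign 0]expr0; ring.
rewrite (pendant_sum_inr (fun u n => half_sign n * half_sign m *
    (pendant_coef C u w * ((odd n == odd l) && (odd m == odd l))%:R
   - (-1) ^+ odd l *
     [&& u == w, odd (minn n m) != odd l & odd (maxn n m) == odd l]%:R))).
(* As c_(i+2) = - c_i, the [a] terms of the two neighbours cancel; at the far end the only one left
   vanishes by parity. *)
rewrite half_signSS /= negbK; move: (pendant_coef C v w) => a.
case: i => i Hi /=.
(* For [m != i.+1] the Q terms cancel in the same way. For [m = i.+1] and [v = w] exactly one
   survives, and [half_signMS] makes it 1. *)
case: (ltngtP m i.+1) => [mi | im | mE].
- have -> : minn i.+2 m = m by lia.
  have -> : minn i m = m by lia.
  have -> : maxn i.+2 m = i.+2 by lia.
  have -> : maxn i m = i by lia.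
  rewrite /= negbK andbF; case: (ltnP i.+1 l) => il; first by rewrite /=; ring.
  have -> : l = i.+1 by lia.
  rewrite /=; case: (odd i); rewrite /= !andbF /=; ring.
- have -> : minn i.+2 m = i.+2 by lia.
  have -> : minn i m = i by lia.
  have -> : maxn i.+2 m = m by lia.
  have -> : maxn i m = m by lia.
  have -> : (i.+1 < l)%N by lia.
  by rewrite /= negbK andbF /=; ring.
- rewrite mE /=.
  have -> : minn i.+2 i.+1 = i.+1 by lia.
  have -> : minn i i.+1 = i by lia.
  have -> : maxn i.+2 i.+1 = i.+2 by lia.
  have -> : maxn i i.+1 = i.+1 by lia.
  rewrite andbT mulNr !half_signMS /= negbK.
  case: (ltnP i.+1 l) => il.
    by case: (v == w); case: (odd i); case: (odd l); rewrite /=; ring.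
  have -> : l = i.+1 by lia.
  by rewrite /=; case: (v == w); case: (odd i); rewrite /=; ring.
Qed.

(** Reduces the sign of the whole inverse to that of its coefficient matrix; [b] selects nonnegative
    or nonpositive. *)
Lemma pendant_kernel_signed (C : G -> G -> R) (b : bool) (d : G -> R) :
    (forall v, d v = 1 \/ d v = -1) ->
    (forall v w, 0 <= (-1) ^+ b * (d v * pendant_coef C v w * d w)) ->
  exists2 D, signature_mx D &
    forall i j, 0 <= (-1) ^+ b * (D *m kernel_mx (pendant_kernel C) *m D) i j.
Proof.
(* [e] solves - (-1)^l e = (-1)^b and is placed on the depths of parity opposite to [l]. *)
move=> Hd Hpos; pose e : R := - (-1) ^+ odd l * (-1) ^+ b.
pose s (x : pendant_path G l) := d (pendant_base x) *
  half_sign (pendant_depth x) *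
  (if odd (pendant_depth x) == odd l then 1 else e).
have sgn (k : nat) : (-1) ^+ k = 1 :> R \/ (-1) ^+ k = -1 :> R.
  by rewrite -signr_odd; case: (odd k); [right | left].
have Hs x : s x = 1 \/ s x = -1.
  rewrite /s /e /half_sign; case: (Hd (pendant_base x)) => ->;
  case: (sgn (pendant_depth x)./2) => ->; case: (sgn (odd l)) => ->;
  case: (sgn b) => ->; case: (_ == _); rewrite ?(mulN1r, opprK, mul1r);
  by [left | right].
exists (diag_mx (\row_(i < #|pendant_path G l|) s (enum_val i))).
  exact: signature_mx_diag.
move=> i j; rewrite signature_conjE; last exact: signature_mx_diag.
rewrite !mxE !eqxx /s /pendant_kernel.
move: (enum_val i) (enum_val j) => x y.
move: (pendant_base x) (pendant_base y) => v w.
move: (pendant_depth x) (pendant_depth y) => n m.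
set a := pendant_coef C v w.
set f := fun n : nat => if odd n == odd l then 1 else e.
set g := [&& _, _ & _].
set p := (-1) ^+ b.
have -> : p * (d v * half_sign n * f n *
     (half_sign n * half_sign m *
      (a * ((odd n == odd l) && (odd m == odd l))%:R - (-1) ^+ odd l * g%:R)) *
     (d w * half_sign m * f m)) =
  p * (d v * a * d w) *
    (((odd n == odd l) && (odd m == odd l))%:R * f n * f m)
  + p * d v * d w * f n * f m * (- (-1) ^+ odd l * g%:R).
  (* The half signs of the conjugation meet those of the kernel, so each occurs squared. *)
  transitivity ((half_sign n * half_sign n) * (half_sign m * half_sign m) *
    (p * (d v * a * d w) *
    (((odd n == odd l) && (odd m == odd l))%:R * f n * f m)
  + p * d v * d w * f n * f m * (- (-1) ^+ odd l * g%:R))); first by ring.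
  by rewrite !half_sign_sqr !mul1r.
apply: addr_ge0.
  apply: mulr_ge0; first exact: Hpos.
  by rewrite /f; case: eqP => _; case: eqP => _; rewrite /= ?mul0r ?mul1r ?ler01.
rewrite {}/g; case: eqP => [<-|_] /=; last by rewrite !mulr0.
have [/andP[H1 H2] | _] := boolP (_ && _); last by rewrite !mulr0.
(* Only the smaller depth has parity opposite to [l], so [e] occurs exactly once. *)
have fnm : f n * f m = e.
  have [nm|nm] := leqP n m; move: H1 H2.
    rewrite (minn_idPl nm) (maxn_idPr nm) /f => /negPf -> ->.
    by rewrite mulr1.
  rewrite (minn_idPr (ltnW nm)) (maxn_idPl (ltnW nm)) /f => /negPf -> ->.
  by rewrite mul1r.
rewrite -(mulrA _ (f n)) fnm /e; set q := (-1) ^+ odd l.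
have -> : p * d v * d v * (- q * p) * (- q * 1) =
    (p * p) * (q * q) * (d v * d v) by ring.
by apply: mulr_ge0; [apply: mulr_ge0 |]; rewrite -expr2 sqr_ge0.
Qed.

End PendantPath.

(** * Sign and integrality conclusions for each parity of [l] *)

Theorem proposition7 (R : archiRealFieldType) (G : sgraph) (l : nat)
    (hB : adjmx R G \in unitmx) (hl : (1 <= l)%N) :
  adjmx R (pendant_path G l) \in unitmx
  /\ (odd l ->
      negatively_integrally_invertible R (pendant_path G l)
      /\ ((exists2 D : 'M[R]_#|G|,
             signature_mx D & D *m adjmx R G *m D \is a mxOver Num.npos) ->
          positively_integrally_invertible R (pendant_path G l)))
  /\ (~~ odd l ->
      (positively_invertible R G ->
       positively_invertible R (pendant_path G l))
      /\ (negatively_invertible R G ->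
          negatively_invertible R (pendant_path G l))).

Proof.
set A := adjmx R G in hB *.
pose C v w := invmx A (enum_rank v) (enum_rank w).
have HC v w : \sum_u (sedge v u)%:R * C u w = (v == w)%:R.
  rewrite /C -(adjmx_sum (fun j => invmx A j (enum_rank w))).
  transitivity ((A *m invmx A) (enum_rank v) (enum_rank w)); first by rewrite mxE.
  by rewrite mulmxV // mxE (inj_eq enum_rank_inj).
have [uM invM] := adjmx_inverse (pendant_kernel_inverse hl HC).
split=> //.
have sgnD (D : 'M[R]_#|G|) : signature_mx D ->
    forall v, D (enum_rank v) (enum_rank v) = 1
           \/ D (enum_rank v) (enum_rank v) = -1.
  by case=> _ HD v; apply: HD.
split=> lo; last first.
  (* For [l] even the coefficient matrix is B^-1, so the signature given for [G] serves for either
     sign. *)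
  have HD (b : bool) (D : 'M[R]_#|G|) : signature_mx D ->
      (forall i j, 0 <= (-1) ^+ b * (D *m invmx A *m D) i j) ->
    exists2 D', signature_mx D' & forall i j,
      0 <= (-1) ^+ b *
        (D' *m invmx (adjmx R (pendant_path G l)) *m D') i j.
    move=> sD H; rewrite invM; apply: (pendant_kernel_signed (sgnD D sD)).
    move=> v w; have := H (enum_rank v) (enum_rank w).
    by rewrite signature_conjE // /pendant_coef (negPf lo).
  split=> -[_ [D sD]].
    move=> /mxOver_nnegP/(HD _ _ sD)[D' sD' /mxOver_nnegP HD'].
    by split=> //; exists D'.
  move=> /mxOver_nposP/(HD _ _ sD)[D' sD' /mxOver_nposP HD'].
  by split=> //; exists D'.
have Hcoef v w : pendant_coef l C v w = - A (enum_rank v) (enum_rank w).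
  by rewrite /pendant_coef lo /A mxE !enum_rankK.
(* For [l] odd B^-1 does not occur in the inverse: its entries are built from signs, booleans and
   B. *)
have intM : invmx (adjmx R (pendant_path G l)) \is a mxOver Num.int.
  rewrite invM; apply/mxOverP=> i j; rewrite mxE /pendant_kernel Hcoef.
  by rewrite /half_sign /A mxE
    !(rpredM, rpredB, rpredN, rpred_nat, rpredX, rpred1).
have intD (D : 'M[R]_#|pendant_path G l|) : signature_mx D ->
    D *m invmx (adjmx R (pendant_path G l)) *m D \is a mxOver Num.int.
  move=> sD; apply/mxOverP=> i j; rewrite signature_conjE //.
  move/mxOverP: intM => intM; have [_ HD] := sD.
  have intDi k : D k k \is a Num.int.
    by case: (HD k) => ->; rewrite ?rpredN rpred1.
  by rewrite !rpredM.
have detM : \det (adjmx R (pendant_path G l)) = 1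
    \/ \det (adjmx R (pendant_path G l)) = -1.
  apply: det_int_inverse => //.
  by apply/mxOverP=> i j; rewrite mxE rpred_nat.
split.
  split=> //.
  (* The coefficient matrix -B is already nonpositive, so the trivial signature suffices on the
     bases. *)
  have [v|v w|D sD HD] := @pendant_kernel_signed R G l C true (fun=> 1).
  - by left.
  - by rewrite Hcoef mul1r mulr1 expr1 mulN1r opprK /A mxE ler0n.
  exists D; split=> //; first exact: intD.
  by apply/mxOver_nposP => i j; rewrite invM.
case=> D0 sD0 /mxOverP HD0; split=> //.
(* Conjugation by [D0] makes -B nonnegative. *)
have [v w|D sD HD] := @pendant_kernel_signed R G l C false _ (sgnD _ sD0).
- have := HD0 (enum_rank v) (enum_rank w); rewrite signature_conjE // nposrE.
  by rewrite Hcoef expr0 mul1r mulrN mulNr oppr_ge0.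
exists D; split=> //; first exact: intD.
by apply/mxOver_nnegP => i j; rewrite invM.
Qed.
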